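(* Let $X$ be a countably compact sequential space and let $\mathcal S=(X,(f_i)_{i\in I})$ be a locally finite non-overlapping Infinite Iterated Function System in which each $f_i:X\to X$ is continuous. Then $F_{\mathcal S}(A)$ is a nonempty closed subset of $X$ for every nonempty closed $A\subseteq X$; the set $\bigcap_{n\in\mathbb N}F_{\mathcal S}^n(X)$ is nonempty and closed, and it is the greatest fixed point of $F_{\mathcal S}$ (with respect to inclusion). Moreover, if $X$ is metrizable, then the sequence $(F_{\mathcal S}^n(X))_{n\in\mathbb N}$ of nonempty closed sets converges to $\bigcap_{n\in\mathbb N}F_{\mathcal S}^n(X)$ with respect to the Hausdorff-Pompeiu metric.
   Context: Countably compact spaces are assumed Hausdorff. A topological space is sequential if every sequentially closed subset is closed. An Infinite Iterated Function System (IIFS) $\mathcal S=(X,(f_i)_{i\in I})$ is a family of selfmaps $f_i:X\to X$ of a topological space $X$, indexed by an arbitrary set $I$; $X$ and $I$ are nonempty. It is non-overlapping if $f_i(B)\cap f_j(B)=\varnothing$ for all $B\subseteq X$ and all $i\ne j$ in $I$ (equivalently $f_i(X)\cap f_j(X)=\varnothing$ for $i\neq j$). It is locally finite if every $y\in X$ has a neighbourhood $V_y$ such that $\{i\in I: V_y\cap f_i(X)\neq\varnothing\}$ is finite. The operator $F_{\mathcal S}$ on nonempty subsets of $X$ is $F_{\mathcal S}(A):=\bigcup_{i\in I}f_i(A)$, and $F_{\mathcal S}^n$ is its $n$-fold composition; a fixed point is a nonempty set $A$ with $F_{\mathcal S}(A)=A$. When $X$ is metrizable with compatible metric $d$, the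 Hausdorff-Pompeiu metric is $h(A,B)=\max\{\sup_{x\in A}\inf_{y\in B}d(x,y),\ \sup_{y\in B}\inf_{x\in A}d(x,y)\}$. *)

(* Defs.v *)
From HB Require Import structures.
From mathcomp Require Import all_boot all_order all_algebra.
From mathcomp Require Import all_classical all_reals all_analysis.

Set Implicit Arguments.
Unset Strict Implicit.
Unset Printing Implicit Defensive.

Import Order.TTheory GRing.Theory Num.Theory.
Import numFieldNormedType.Exports.

Local Open Scope classical_set_scope.
Local Open Scope ring_scope.

(* The Hausdorff axiom is part of the notion. Covers indexed by [nat] may
   repeat members, so finite covers are included. *)
Definition countably_compact_space (X : topologicalType) : Prop :=
  hausdorff_space X /\
  forall U : nat -> set X, (forall n, open (U n)) ->
    [set: X] `<=` \bigcup_n U n ->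
    finite_subset_cover [set: nat] U [set: X].

Definition sequentially_closed (X : topologicalType) (A : set X) : Prop :=
  forall (u : nat -> X) (x : X),
    (forall n, A (u n)) -> u @ \oo --> x -> A x.

Definition sequential_space (X : topologicalType) : Prop :=
  forall A : set X, sequentially_closed A -> closed A.

(* An iterated function system on [X] indexed by [I] is represented by its
   family of maps [f : I -> X -> X]; [I] need not be finite. *)
Definition non_overlapping (X I : Type) (f : I -> X -> X) : Prop :=
  forall (B : set X) (i j : I), i <> j -> (f i @` B) `&` (f j @` B) = set0.

Definition locally_finite (X : topologicalType) (I : Type)
    (f : I -> X -> X) : Prop :=
  forall y : X, exists2 V : set X, nbhs y V &
    finite_set [set i | V `&` (f i @` [set: X]) !=set0].

(* Defined on all subsets; it maps nonempty sets to nonempty sets as soon as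
   [I] is nonempty. *)
Definition ifs_op (X I : Type) (f : I -> X -> X) (A : set X) : set X :=
  \bigcup_i (f i @` A).

Definition ifs_fixed_point (X I : Type) (f : I -> X -> X) (A : set X) : Prop :=
  A !=set0 /\ ifs_op f A = A.

Definition ifs_greatest_fixed_point (X I : Type) (f : I -> X -> X)
    (K : set X) : Prop :=
  ifs_fixed_point f K /\ forall A, ifs_fixed_point f A -> A `<=` K.

Definition compatible_metric (R : realType) (X : topologicalType)
    (d : X -> X -> R) : Prop :=
  [/\ forall x y, d x y = 0 <-> x = y,
      forall x y, d x y = d y x,
      forall x y z, d x z <= d x y + d y z &
      forall x, nbhs x = nbhs_ball_ (fun a (e : R) => [set b | d a b < e]) x].

(* Extended-real valued, so that the suprema and infima are meaningful without
   any boundedness assumption. *)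
Definition hausdorff_pompeiu (R : realType) (X : Type) (d : X -> X -> R)
    (A B : set X) : \bar R :=
  maxe (ereal_sup [set ereal_inf [set (d x y)%:E | y in B] | x in A])
       (ereal_sup [set ereal_inf [set (d x y)%:E | x in A] | y in B]).

(* Main.v *)
Require Import Defs.
From mathcomp Require Import all_boot all_order all_algebra.
From mathcomp Require Import finmap.
From mathcomp Require Import all_classical all_reals all_analysis.

(** A countably compact space obeys Cantor's theorem on decreasing sequences of
    nonempty closed sets ([decreasing_closed_bigcap_neq0]), and every assertion
    follows from it.

    Closedness: a continuous image of a closed set is closed, because in a
    sequential space only limits of sequences have to be tested and Cantor's
    theorem lifts such a limit to the source ([closed_image]); the images under
    the various maps then form a locally finite family of closed sets, whose
    union is closed ([closed_ifs_op]).

    Fixed point: the iterates of the whole space decrease, so their intersection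
    [K] is closed and nonempty, and by monotonicity it contains every fixed
    point. That [K] is itself fixed amounts to the operator commuting with
    decreasing intersections ([ifs_op_bigcap]). Disjointness of the images is
    what makes this work: a point lying in the image of every iterate comes from
    one single map, whose closed fibre meets all the iterates and thus meets [K].

    Convergence: by the general form of Cantor's theorem, every open set
    containing [K] contains some iterate ([decreasing_closed_sub_open]). Applied to the
    neighbourhood of [K] of radius [e], this bounds the distance by [e] from some
    index on, since [K] is included in each iterate. *)

Set Implicit Arguments.
Unset Strict Implicit.
Unset Printing Implicit Defensive.

Import Order.TTheory GRing.Theory Num.Theory.
Import numFieldNormedType.Exports.

Local Open Scope classical_set_scope.
Local Open Scope ring_scope.

Definition decreasing_sets (X : Type) (C : nat -> set X) : Prop :=
  forall m n, (m <= n)%N -> C n `<=` C m.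

(** * Countably compact and sequential spaces *)

(** The complements of the [C n] together with [U] cover the space; in a finite
    subcover, the complement of the [C n] of largest index contains all the
    others. *)
Lemma decreasing_closed_sub_open (X : topologicalType) (C : nat -> set X)
    (U : set X) :
  countably_compact_space X -> (forall n, closed (C n)) ->
  decreasing_sets C -> open U -> \bigcap_n C n `<=` U ->
  exists n, C n `<=` U.
Proof.
move=> [_ ccX] Ccl Cdec Uop CU.
have [|x _|D _ Dcov] := ccX (fun n => U `|` ~` C n).
- by move=> n; apply: openU => //; rewrite openC.
- case: (pselect (U x)) => [Ux|nUx]; first by exists 0%N => //; left.
  apply: contrapT => ncov; apply: nUx; apply: CU => n _.
  by apply: contrapT => nCx; apply: ncov; exists n => //; right.
exists (\max_(i <- D) i)%N => x Cx.
have [i /= iD [//|]] := Dcov x Logic.I.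
by case; apply: (Cdec i) Cx; exact: (@leq_bigmax_seq _ _ xpredT id).
Qed.

(** Cantor's intersection theorem: an empty intersection would be included in
    the empty open set, and so would some [C n]. *)
Lemma decreasing_closed_bigcap_neq0 (X : topologicalType) (C : nat -> set X) :
  countably_compact_space X -> (forall n, closed (C n)) ->
  decreasing_sets C -> (forall n, C n !=set0) -> \bigcap_n C n !=set0.
Proof.
move=> ccX Ccl Cdec Cn0; apply: contrapT => C0.
have [|n Cn] := decreasing_closed_sub_open ccX Ccl Cdec (@open0 X).
  by move=> x Cx; apply: C0; exists x.
by have [x /Cn] := Cn0 n.
Qed.

(** For [u n = g (a n)] converging to [y], with each [a n] in [A], the theorem
    on decreasing sets gives a point of [A] whose image is a cluster point of
    [u], hence equal to [y]; convergent subsequences of [a] are not involved. *)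
Lemma closed_image (X Y : topologicalType) (g : X -> Y) (A : set X) :
  countably_compact_space X -> hausdorff_space Y -> sequential_space Y ->
  continuous g -> closed A -> closed (g @` A).
Proof.
move=> ccX Yhs Yseq gc Acl; apply: Yseq => u y uA uy.
pose C n := A `&` g @^-1` closure (u @` [set k | (n <= k)%N]).
have [||n|a Ca] := @decreasing_closed_bigcap_neq0 X C ccX.
- move=> n; apply: closedI => //.
  by move/continuous_closedP: gc; apply; exact: closed_closure.
- move=> m n mn x [Ax gx]; split=> //.
  apply: closure_subset gx => _ [k /= nk <-].
  by exists k => //=; exact: leq_trans nk.
- have [a Aa gau] := uA n; exists a; split=> //=.
  by rewrite gau; apply: subset_closure; exists n => //=.
exists a; first by case: (Ca 0%N Logic.I).
apply/esym/Yhs => P Q Py Qga.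
have [n _ nP] := uy P Py.
have [_ gaC] := Ca n Logic.I.
have [_ [[k /= nk <-] Quk]] := gaC Q Qga.
by exists (u k); split=> //; exact: nP.
Qed.

(** * The Hutchinson operator *)

Lemma ifs_op_neq0 (X I : Type) (f : I -> X -> X) (A : set X) :
  [set: I] !=set0 -> A !=set0 -> ifs_op f A !=set0.
Proof. by move=> [i _] [a Aa]; exists (f i a), i => //; exists a. Qed.

Lemma ifs_opS (X I : Type) (f : I -> X -> X) (A B : set X) :
  A `<=` B -> ifs_op f A `<=` ifs_op f B.
Proof. by move=> AB _ [i _ [a Aa <-]]; exists i => //; exists a => //; exact: AB. Qed.

Lemma iter_ifs_op_decreasing (X I : Type) (f : I -> X -> X) :
  decreasing_sets (fun n => iter n (ifs_op f) [set: X]).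
Proof.
have step n : iter n.+1 (ifs_op f) [set: X] `<=` iter n (ifs_op f) [set: X].
  by elim: n => [//|n IH]; exact: ifs_opS IH.
move=> m n /subnKC <-; elim: (n - m)%N => [|k IH]; first by rewrite addn0.
by rewrite addnS; apply: subset_trans IH; exact: step.
Qed.

(** Near a given point only finitely many of the sets [f i @` A] are visible,
    and a finite union of closed sets is closed. *)
Lemma closed_ifs_op (X : topologicalType) (I : Type) (f : I -> X -> X)
    (A : set X) :
  locally_finite f -> (forall i, closed (f i @` A)) -> closed (ifs_op f A).
Proof.
move=> f_lf fA y clF; have [V Vy finJ] := f_lf y.
set J := [set i | _] in finJ.
have clJ : closed (\bigcup_(i in J) (f i @` A)).
  (* the index type carries no choice structure of its own *)
  by apply: (@closed_bigcup _ {classic I}).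
suff [i _ fiA] : (\bigcup_(i in J) (f i @` A)) y by exists i.
apply: clJ => W Wy.
have [_ [[i _ [a Aa <-]] [Wa Va]]] := clF _ (filterI Wy Vy).
exists (f i a); split=> //; exists i; last by exists a.
by exists (f i a); split=> //; exists a.
Qed.

(** A point of the right-hand side has a preimage [a n] in [C n] for every
    [n]. As the images are pairwise disjoint, one map [f i] serves for all [n],
    so that the fibre of [f i] meets every [C n], hence their intersection. *)
Lemma ifs_op_bigcap (X : topologicalType) (I : Type) (f : I -> X -> X)
    (C : nat -> set X) :
  countably_compact_space X -> (forall i, continuous (f i)) ->
  non_overlapping f -> (forall n, closed (C n)) -> decreasing_sets C ->
  ifs_op f (\bigcap_n C n) = \bigcap_n ifs_op f (C n).
Proof.
move=> ccX fc fno Ccl Cdec; apply/seteqP; split=> x.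
  by move=> Fx n _; apply: ifs_opS Fx => y; exact.
move=> Fx; have [i _ [a _ fia]] := Fx 0%N Logic.I.
pose D n := C n `&` f i @^-1` [set x].
have [||n|b Db] := @decreasing_closed_bigcap_neq0 X D ccX.
- move=> n; apply: closedI => //.
  move/continuous_closedP: (fc i); apply.
  by apply: accessible_closed_set1; apply: hausdorff_accessible; case: ccX.
- by move=> m n mn y [Cy fy]; split=> //; exact: Cdec Cy.
- have [j _ [b Cb fjb]] := Fx n Logic.I.
  exists b; split=> //=; rewrite -fjb.
  suff -> : i = j by [].
  apply: contrapT => /(fno [set: X]) dis.
  suff : (@set0 X) x by [].
  by rewrite -dis; split; [exists a | exists b].
exists i => //; exists b; last by case: (Db 0%N Logic.I).
by move=> n _; case: (Db n Logic.I).
Qed.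

(** * Hausdorff-Pompeiu convergence *)

Lemma compatible_metric_ge0 (R : realType) (X : topologicalType)
    (d : X -> X -> R) (x y : X) : compatible_metric d -> 0 <= d x y.
Proof.
move=> [d0 dC dT _]; have := dT x y x.
by rewrite (dC y x) (proj2 (d0 x x) erefl) -mulr2n pmulrn_lge0.
Qed.

Lemma hausdorff_pompeiu_ge0 (R : realType) (X : topologicalType)
    (d : X -> X -> R) (A B : set X) :
  compatible_metric d -> A !=set0 -> (0 <= hausdorff_pompeiu d A B)%E.
Proof.
move=> dm [a Aa]; rewrite /hausdorff_pompeiu le_max; apply/orP; left.
apply: le_ereal_sup_tmp; exists (ereal_inf [set (d a y)%:E | y in B]).
  by exists a.
apply: le_ereal_inf_tmp => _ [y _ <-].
by rewrite lee_fin; exact: compatible_metric_ge0.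
Qed.

Lemma hausdorff_pompeiu_le (R : realType) (X : topologicalType)
    (d : X -> X -> R) (A B : set X) (e : R) :
  (forall x, A x -> exists2 y, B y & d x y <= e) ->
  (forall y, B y -> exists2 x, A x & d x y <= e) ->
  (hausdorff_pompeiu d A B <= e%:E)%E.
Proof.
move=> AB BA; rewrite /hausdorff_pompeiu ge_max; apply/andP; split.
- apply: ge_ereal_sup => _ [x Ax <-]; have [y By dxy] := AB x Ax.
  by apply: ge_ereal_inf; exists (d x y)%:E; [exists y | rewrite lee_fin].
- apply: ge_ereal_sup => _ [y By <-]; have [x Ax dxy] := BA y By.
  by apply: ge_ereal_inf; exists (d x y)%:E; [exists x | rewrite lee_fin].
Qed.

(** The union of the [e]-balls centred in the intersection contains the latter
    in its interior, hence contains some [C n], and then all later ones. *)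
Lemma decreasing_closed_cvg_hausdorff_pompeiu (R : realType)
    (X : topologicalType) (d : X -> X -> R) (C : nat -> set X) :
  countably_compact_space X -> compatible_metric d ->
  (forall n, closed (C n)) -> decreasing_sets C -> (forall n, C n !=set0) ->
  (fun n => hausdorff_pompeiu d (C n) (\bigcap_n C n)) @ \oo
    --> (0 : \bar R)%E.
Proof.
move=> ccX dm Ccl Cdec Cn0; have [d0 dC _ dnbhs] := dm.
have small e : 0 < e ->
    \forall n \near \oo, (hausdorff_pompeiu d (C n) (\bigcap_n C n) <= e%:E)%E.
  move=> e0.
  have KU : \bigcap_n C n `<=`
      interior (\bigcup_(y in \bigcap_n C n) [set x | d y x < e]).
    move=> y Ky; rewrite /interior /= dnbhs; exists e => //= x yx.
    by exists y.
  have [N CN] := decreasing_closed_sub_open ccX Ccl Cdec (@open_interior _ _) KU.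
  exists N => // n /= Nn; apply: hausdorff_pompeiu_le => [x Cx|y Ky].
    have /CN/interior_subset[y Ky /= yx] := Cdec _ _ Nn _ Cx.
    by exists y => //; rewrite dC ltW.
  exists y; first exact: Ky.
  by rewrite (proj2 (d0 y y) erefl) ltW.
have ge0 n := hausdorff_pompeiu_ge0 (\bigcap_n C n) dm (Cn0 n).
apply/fine_cvgP; split.
  apply: filterS (small 1 ltr01) => n hn.
  by rewrite ge0_fin_numE //; exact: le_lt_trans hn (ltry _).
apply/cvgrPdist_le => e e0; apply: filterS (small e e0) => n hn.
rewrite /= sub0r normrN ger0_norm; last exact: fine_ge0.
by rewrite -lee_fin fineK // ge0_fin_numE //; exact: le_lt_trans hn (ltry _).
Qed.

(** * Attractor of the system *)

Theorem theorem4p1 (R : realType) (X : topologicalType) (I : Type)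
    (f : I -> X -> X)
    (X_nonempty : [set: X] !=set0) (I_nonempty : [set: I] !=set0)
    (X_cc : countably_compact_space X) (X_seq : sequential_space X)
    (f_lf : locally_finite f) (f_no : non_overlapping f)
    (f_cont : forall i, continuous (f i)) :
  let K := \bigcap_n iter n (ifs_op f) [set: X] in
  [/\ forall A : set X, A !=set0 -> closed A ->
        ifs_op f A !=set0 /\ closed (ifs_op f A),
      K !=set0,
      closed K,
      ifs_greatest_fixed_point f K &
      forall d : X -> X -> R, compatible_metric d ->
        (forall n, iter n (ifs_op f) [set: X] !=set0 /\
                   closed (iter n (ifs_op f) [set: X])) /\
        (fun n => hausdorff_pompeiu d (iter n (ifs_op f) [set: X]) K) @ \oo
          --> (0 : \bar R)%E].
Proof.
move=> K.
have [Xhs _] := X_cc.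
have Fcl A : closed A -> closed (ifs_op f A).
  by move=> Acl; apply: closed_ifs_op => // i; exact: closed_image.
have Cn0 n : iter n (ifs_op f) [set: X] !=set0.
  by elim: n => //= n IH; exact: ifs_op_neq0.
have Ccl n : closed (iter n (ifs_op f) [set: X]).
  by elim: n => [|n IH]; [exact: closedT | exact: Fcl].
have Cdec := @iter_ifs_op_decreasing X I f.
have K0 : K !=set0 by exact: decreasing_closed_bigcap_neq0.
split=> //.
- by move=> A A0 Acl; split; [exact: ifs_op_neq0 | exact: Fcl].
- by apply: closed_bigI.
- split; last first.
    move=> A [_ FA] x Ax n _; elim: n x Ax => [//|n IH] x.
    by rewrite -{1}FA; exact: ifs_opS.
  split=> //; rewrite ifs_op_bigcap//; apply/seteqP; split=> x Kx n _.
    by apply: Cdec (leqnSn n) _ _; exact: Kx.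
  exact: (Kx n.+1).
- by move=> d dm; split; [|exact: decreasing_closed_cvg_hausdorff_pompeiu].
Qed.
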